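(* Let $(A,\nwarrow,\nearrow,\swarrow,\searrow)$ be a quadri-algebra and let $r\in A\otimes A$ be skew-symmetric. If $r$ is a solution of the $Q$-equations $$r_{23}\wedge r_{12}-r_{13}\succ r_{23}+r_{12}\swarrow r_{13}=0,\qquad r_{23}\vee r_{12}-r_{12}\prec r_{13}+r_{13}\nearrow r_{23}=0,$$ then the comultiplications defined for $x\in A$ by $$\alpha(x)=(-1\otimes L_\searrow(x)+R_\star(x)\otimes1)r,\quad \beta(x)=(1\otimes L_\vee(x)-R_\prec(x)\otimes1)r,$$ $$\tilde\alpha(x)=(1\otimes L_\succ(x)-R_\wedge(x)\otimes1)r,\quad \tilde\beta(x)=(-1\otimes L_\star(x)+R_\nwarrow(x)\otimes1)r$$ make $(A,\nwarrow,\nearrow,\swarrow,\searrow,\alpha,\beta,\tilde\alpha,\tilde\beta)$ into a quadri-bialgebra.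
   Context: All vector spaces are finite-dimensional over a fixed field $\mathbb F$. A quadri-algebra $(A,\nwarrow,\nearrow,\swarrow,\searrow)$ is a vector space with four bilinear operations; put $x\succ y=x\nearrow y+x\searrow y$, $x\prec y=x\nwarrow y+x\swarrow y$, $x\vee y=x\swarrow y+x\searrow y$, $x\wedge y=x\nwarrow y+x\nearrow y$, $x\star y=x\nwarrow y+x\nearrow y+x\swarrow y+x\searrow y$; the axioms are, for all $x,y,z$: $(x\nwarrow y)\nwarrow z=x\nwarrow(y\star z)$, $(x\nearrow y)\nwarrow z=x\nearrow(y\prec z)$, $(x\wedge y)\nearrow z=x\nearrow(y\succ z)$, $(x\swarrow y)\nwarrow z=x\swarrow(y\wedge z)$, $(x\searrow y)\nwarrow z=x\searrow(y\nwarrow z)$, $(x\vee y)\nearrow z=x\searrow(y\nearrow z)$, $(x\prec y)\swarrow z=x\swarrow(y\vee z)$, $(x\succ y)\swarrow z=x\searrow(y\swarrow z)$, $(x\star y)\searrow z=x\searrow(y\searrow z)$. $L_\circ(x)y=x\circ y=R_\circ(y)x$. The element $r$ is skew-symmetric if $\tau(r)=-r$, $\tau$ being the flip. For $r=\sum_ia_i\otimes b_i$ and a bilinear operation $\diamond$: $r_{12}\diamond r_{13}=\sum_{i,j}a_i\diamond a_j\otimes b_i\otimes b_j$, $r_{13}\diamond r_{23}=\sum_{i,j}a_i\otimes a_j\otimes b_i\diamond b_j$, $r_{23}\diamond r_{12}=\sum_{i,j}a_j\otimes a_i\diamond b_j\otimes b_i$. $(A,\alpha,\beta,\tilde\alpha,\tilde\beta)$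 with linear maps $A\to A\otimes A$ is a quadri-coalgebra if $(A^*,\alpha^*,\beta^*,\tilde\alpha^*,\tilde\beta^* )$ is a quadri-algebra (in the order $\nwarrow,\nearrow,\swarrow,\searrow$), where $\langle\alpha^*(a^*\otimes b^* ),x\rangle=\langle a^*\otimes b^*,\alpha(x)\rangle$, etc. A quadri-bialgebra is a quadri-algebra that is also a quadri-coalgebra such that for all $x,y\in A$: $\tilde\alpha(x\star y)=(R_\wedge(y)\otimes1)\tilde\alpha(x)+(1\otimes L_\succ(x))\tilde\alpha(y)$; $\beta(x\star y)=(R_\prec(y)\otimes1)\beta(x)+(1\otimes L_\vee(x))\beta(y)$; $(\beta+\tilde\beta)(x\wedge y)=(R_\nwarrow(y)\otimes1)(\beta+\tilde\beta)(x)+(1\otimes L_\wedge(x))\tilde\beta(y)$; $(\alpha+\tilde\alpha)(x\wedge y)=(R_\wedge(y)\otimes1)(\alpha+\tilde\alpha)(x)+(1\otimes L_\nearrow(x))\tilde\alpha(y)$; $(\beta+\tilde\beta)(x\vee y)=(1\otimes L_\vee(x))(\beta+\tilde\beta)(y)+(R_\swarrow(y)\otimes1)\beta(x)$; $(\alpha+\tilde\alpha)(x\vee y)=(1\otimes L_\searrow(x))(\alpha+\tilde\alpha)(y)+(R_\vee(y)\otimes1)\alpha(x)$; $(\alpha+\beta)(x\succ y)=(1\otimes L_\searrow(x))(\alpha+\beta)(y)+(R_\succ(y)\otimes1)\alpha(x)$; $(\tilde\alpha+\tilde\beta)(x\succ y)=(1\otimes L_\succ(x))(\tilde\alpha+\tilde\beta)(y)+(R_\nearrow(y)\otimes1)\tilde\alpha(x)$;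 $(\alpha+\beta)(x\prec y)=(R_\prec(y)\otimes1)(\alpha+\beta)(x)+(1\otimes L_\swarrow(x))\beta(y)$; $(\tilde\alpha+\tilde\beta)(x\prec y)=(R_\nwarrow(y)\otimes1)(\tilde\alpha+\tilde\beta)(x)+(1\otimes L_\prec(x))\tilde\beta(y)$; $(1\otimes L_\succ(y)-R_\wedge(y)\otimes1)\tau\beta(x)=(1\otimes R_\prec(x)-L_\vee(x)\otimes1)\tilde\alpha(y)$; $(1\otimes R_\nwarrow(x)-L_\vee(x)\otimes1)(\alpha+\tilde\alpha)(y)=(1\otimes L_\nearrow(y))\tau\beta(x)-(R_\vee(y)\otimes1)\tau\tilde\beta(x)$; $(R_\wedge(y)\otimes1-1\otimes L_\searrow(y))(\tau\beta+\tau\tilde\beta)(x)=(L_\wedge(x)\otimes1)\alpha(y)-(1\otimes R_\swarrow(x))\tilde\alpha(y)$; $(1\otimes L_\succ(x)-R_\nwarrow(x)\otimes1)(\tau\alpha+\tau\beta)(y)=(1\otimes R_\succ(y))\tilde\beta(x)-(L_\swarrow(y)\otimes1)\tilde\alpha(x)$; $(1\otimes L_\searrow(x)-R_\prec(x)\otimes1)(\tau\tilde\alpha+\tau\tilde\beta)(y)=(1\otimes R_\nearrow(y))\beta(x)-(L_\prec(y)\otimes1)\alpha(x)$; $(\alpha+\tilde\alpha+\beta+\tilde\beta)(x\swarrow y)=(R_\swarrow(y)\otimes1)(\alpha+\beta)(x)+(1\otimes L_\swarrow(x))(\beta+\tilde\beta)(y)$; $(\alpha+\beta+\tilde\alpha+\tilde\beta)(x\nearrow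 y)=(R_\nearrow(y)\otimes1)(\alpha+\tilde\alpha)(x)+(1\otimes L_\nearrow(x))(\tilde\alpha+\tilde\beta)(y)$; $(L_\swarrow(y)\otimes1)(\alpha+\tilde\alpha)(x)+(1\otimes L_\nearrow(x))(\tau\alpha+\tau\beta)(y)=(R_\swarrow(x)\otimes1)(\tau\tilde\alpha+\tau\tilde\beta)(y)+(1\otimes R_\nearrow(y))(\beta+\tilde\beta)(x)$. *)

(* Defs.v *)
From HB Require Import structures.
From mathcomp Require Import all_boot all_order all_algebra.
Set Implicit Arguments.
Unset Strict Implicit.
Unset Printing Implicit Defensive.
Import GRing.Theory.
Local Open Scope ring_scope.

Section Tensor.
Variable F : fieldType.

Definition is_bilinear (U V W : vectType F) (f : U -> V -> W) : Prop :=
  (forall v, linear (f^~ v)) /\ (forall u, linear (f u)).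

(* U (x) V is modelled by coordinate matrices in the canonical bases of U and V:
   t : tensor U V stands for the sum of the t i j *: (e_i (x) e_j).
   Only the universal property matters: [tprod] is bilinear, and every bilinear
   map b factors uniquely through it, the linear factor being [tlift b]
   ([tprod_bilinear], [tlift_linear], [tlift_tprod], [tlift_unique]). *)
Definition tensor (U V : vectType F) : vectType F :=
  'M[F]_(\dim {:U}, \dim {:V}).

Definition ebase (U : vectType F) (i : 'I_(\dim {:U})) : U :=
  (vbasis {:U})`_i.

Definition ecoord (U : vectType F) (i : 'I_(\dim {:U})) (u : U) : F :=
  coord (vbasis {:U}) i u.

Definition tprod (U V : vectType F) (u : U) (v : V) : tensor U V :=
  \matrix_(i, j) (ecoord i u * ecoord j v).

Definition tlift (U V W : vectType F) (b : U -> V -> W) (t : tensor U V) : W :=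
  \sum_i \sum_j (t : 'M[F]_(_, _)) i j *: b (ebase i) (ebase j).

Lemma tprod_bilinear (U V : vectType F) : is_bilinear (@tprod U V).
Proof.
split=> [v|u] a x y; apply/matrixP => i j; rewrite !mxE /ecoord linearP /=.
- by rewrite mulrDl mulrA.
- by rewrite mulrDr mulrCA.
Qed.

Lemma tlift_linear (U V W : vectType F) (b : U -> V -> W) : linear (tlift b).
Proof.
move=> a s t; rewrite /tlift scaler_sumr -big_split; apply: eq_bigr => i _ /=.
rewrite scaler_sumr -big_split; apply: eq_bigr => j _ /=.
by rewrite !mxE scalerDl scalerA.
Qed.

Lemma ebase_sum (U : vectType F) (u : U) : u = \sum_i ecoord i u *: ebase i.
Proof. exact/coord_vbasis/memvf. Qed.

Lemma ecoord_ebase (U : vectType F) (i j : 'I_(\dim {:U})) :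
  ecoord i (ebase j) = (i == j)%:R.
Proof.
by rewrite /ecoord /ebase coord_free 1?eq_sym // (basis_free (vbasisP _)).
Qed.

Lemma linear_fsum (U W : vectType F) (f : U -> W) (I : finType) (c : I -> F)
    (x : I -> U) :
  linear f -> f (\sum_i c i *: x i) = \sum_i c i *: f (x i).
Proof.
move=> lf; pose g : {linear U -> W} :=
  HB.pack f (GRing.isLinear.Build F U W *:%R f lf).
rewrite -[f]/(g : U -> W) linear_sum; apply: eq_bigr => i _.
by rewrite linearZ.
Qed.

Lemma tlift_tprod (U V W : vectType F) (b : U -> V -> W) (u : U) (v : V) :
  is_bilinear b -> tlift b (tprod u v) = b u v.
Proof.
move=> [bl br]; rewrite [u in RHS]ebase_sum [v in RHS]ebase_sum.
rewrite (linear_fsum _ _ (bl _)); apply: eq_bigr => i _.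
rewrite (linear_fsum _ _ (br _)) scaler_sumr; apply: eq_bigr => j _.
by rewrite scalerA mxE.
Qed.

Lemma tensor_sum (U V : vectType F) (t : tensor U V) :
  t = \sum_i \sum_j (t : 'M[F]_(_, _)) i j *: tprod (ebase i) (ebase j).
Proof.
rewrite [LHS](matrix_sum_delta (t : 'M[F]_(_, _))).
apply: eq_bigr => i _; apply: eq_bigr => j _; congr (_ *: _).
by apply/matrixP => k l; rewrite !mxE !ecoord_ebase -natrM mulnb.
Qed.

Lemma tlift_unique (U V W : vectType F) (b : U -> V -> W)
    (f : tensor U V -> W) :
  linear f -> (forall u v, f (tprod u v) = b u v) -> f =1 tlift b.
Proof.
move=> lf fb t; rewrite [t in LHS]tensor_sum.
pose g : {linear tensor U V -> W} :=
  HB.pack f (GRing.isLinear.Build F (tensor U V) W *:%R f lf).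
rewrite -[f]/(g : _ -> W) linear_sum; apply: eq_bigr => i _.
by rewrite linear_sum; apply: eq_bigr => j _; rewrite linearZ /= fb.
Qed.

Definition tmap (U V U' V' : vectType F) (f : U -> U') (g : V -> V')
    (t : tensor U V) : tensor U' V' :=
  tlift (fun u v => tprod (f u) (g v)) t.

Definition flip (U V : vectType F) (t : tensor U V) : tensor V U :=
  tlift (fun u v => tprod v u) t.

Definition skew_symmetric (A : vectType F) (r : tensor A A) : Prop :=
  flip r = - r.

(* A (x) A (x) A is associated as (A (x) A) (x) A. *)
Definition tprod3 (A : vectType F) (x y z : A) : tensor (tensor A A) A :=
  tprod (tprod x y) z.

(* In the three definitions below a (x) b and a' (x) b' range over the first and
   the second copy of r. *)
Definition r12_r13 (A : vectType F) (op : A -> A -> A) (r : tensor A A) :=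
  tlift (fun a b => tlift (fun a' b' => tprod3 (op a a') b b') r) r.

Definition r13_r23 (A : vectType F) (op : A -> A -> A) (r : tensor A A) :=
  tlift (fun a b => tlift (fun a' b' => tprod3 a a' (op b b')) r) r.

Definition r23_r12 (A : vectType F) (op : A -> A -> A) (r : tensor A A) :=
  tlift (fun a b => tlift (fun a' b' => tprod3 a' (op a b') b) r) r.

Definition dual (A : vectType F) : vectType F := 'Hom(A, F^o).

Definition tpair (A : vectType F) (f g : dual A) (t : tensor A A) : F^o :=
  tlift (fun x y => (f x * g y : F^o)) t.

Definition dual_op (A : vectType F) (c : A -> tensor A A) (f g : dual A) :
    dual A :=
  linfun (fun x => tpair f g (c x)).

Lemma dual_opE (A : vectType F) (c : A -> tensor A A) (f g : dual A) (x : A) :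
  linear c -> dual_op c f g x = tpair f g (c x).
Proof.
move=> lc; have l : linear (fun x => tpair f g (c x)).
  by move=> a y z; rewrite lc /tpair tlift_linear.
pose h : {linear A -> F^o} := HB.pack (fun x => tpair f g (c x))
  (GRing.isLinear.Build F A F^o *:%R _ l).
by rewrite /dual_op -[fun x => _]/(h : A -> F^o) lfunE.
Qed.

End Tensor.

Notation "f ⊗ g" := (tmap f g) (at level 40, no associativity) : ring_scope.

Section Quadri.
Variables (F : fieldType) (A : vectType F).

(* nw, ne, sw, se are the four arrow operations, named by where they point. *)
Record quadri_ops := QuadriOps {
  nw : A -> A -> A;
  ne : A -> A -> A;
  sw : A -> A -> A;
  se : A -> A -> A }.

Variable q : quadri_ops.

Definition succ (x y : A) : A := ne q x y + se q x y.
Definition prec (x y : A) : A := nw q x y + sw q x y.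
Definition vee (x y : A) : A := sw q x y + se q x y.
Definition wedge (x y : A) : A := nw q x y + ne q x y.
Definition star (x y : A) : A := nw q x y + ne q x y + sw q x y + se q x y.

Record quadri_algebra : Prop := QuadriAlgebra {
  nw_bilinear : is_bilinear (nw q);
  ne_bilinear : is_bilinear (ne q);
  sw_bilinear : is_bilinear (sw q);
  se_bilinear : is_bilinear (se q);
  quadri_nw_nw : forall x y z, nw q (nw q x y) z = nw q x (star y z);
  quadri_ne_nw : forall x y z, nw q (ne q x y) z = ne q x (prec y z);
  quadri_wedge_ne : forall x y z, ne q (wedge x y) z = ne q x (succ y z);
  quadri_sw_nw : forall x y z, nw q (sw q x y) z = sw q x (wedge y z);
  quadri_se_nw : forall x y z, nw q (se q x y) z = se q x (nw q y z);
  quadri_vee_ne : forall x y z, ne q (vee x y) z = se q x (ne q y z);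
  quadri_prec_sw : forall x y z, sw q (prec x y) z = sw q x (vee y z);
  quadri_succ_sw : forall x y z, sw q (succ x y) z = se q x (sw q y z);
  quadri_star_se : forall x y z, se q (star x y) z = se q x (se q y z) }.

Definition Lop (op : A -> A -> A) (x : A) : A -> A := fun y => op x y.
Definition Rop (op : A -> A -> A) (y : A) : A -> A := fun x => op x y.

End Quadri.

Record quadri_coalgebra (F : fieldType) (A : vectType F)
    (alpha beta talpha tbeta : A -> tensor A A) : Prop := QuadriCoalgebra {
  alpha_linear : linear alpha;
  beta_linear : linear beta;
  talpha_linear : linear talpha;
  tbeta_linear : linear tbeta;
  dual_quadri_algebra : @quadri_algebra F (dual A)
    (QuadriOps (dual_op alpha) (dual_op beta) (dual_op talpha)
       (dual_op tbeta)) }.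

Section Bialgebra.
Variables (F : fieldType) (A : vectType F) (q : quadri_ops A).
Variables alpha beta talpha tbeta : A -> tensor A A.

Local Notation NW := (nw q).
Local Notation NE := (ne q).
Local Notation SW := (sw q).
Local Notation SE := (se q).
Local Notation P := (prec q).
Local Notation S := (succ q).
Local Notation V := (vee q).
Local Notation W := (wedge q).
Local Notation L := Lop.
Local Notation R := Rop.
Local Notation tau := flip.

Record quadri_bialgebra : Prop := QuadriBialgebra {
  bialg_algebra : quadri_algebra q;
  bialg_coalgebra : quadri_coalgebra alpha beta talpha tbeta;
  bialg_talpha_star : forall x y,
    talpha (star q x y) =
      (R W y ⊗ id) (talpha x) + (id ⊗ L S x) (talpha y);
  bialg_beta_star : forall x y,
    beta (star q x y) =
      (R P y ⊗ id) (beta x) + (id ⊗ L V x) (beta y);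
  bialg_beta_tbeta_wedge : forall x y,
    beta (W x y) + tbeta (W x y) =
      (R NW y ⊗ id) (beta x + tbeta x) + (id ⊗ L W x) (tbeta y);
  bialg_alpha_talpha_wedge : forall x y,
    alpha (W x y) + talpha (W x y) =
      (R W y ⊗ id) (alpha x + talpha x) + (id ⊗ L NE x) (talpha y);
  bialg_beta_tbeta_vee : forall x y,
    beta (V x y) + tbeta (V x y) =
      (id ⊗ L V x) (beta y + tbeta y) + (R SW y ⊗ id) (beta x);
  bialg_alpha_talpha_vee : forall x y,
    alpha (V x y) + talpha (V x y) =
      (id ⊗ L SE x) (alpha y + talpha y) + (R V y ⊗ id) (alpha x);
  bialg_alpha_beta_succ : forall x y,
    alpha (S x y) + beta (S x y) =
      (id ⊗ L SE x) (alpha y + beta y) + (R S y ⊗ id) (alpha x);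
  bialg_talpha_tbeta_succ : forall x y,
    talpha (S x y) + tbeta (S x y) =
      (id ⊗ L S x) (talpha y + tbeta y) + (R NE y ⊗ id) (talpha x);
  bialg_alpha_beta_prec : forall x y,
    alpha (P x y) + beta (P x y) =
      (R P y ⊗ id) (alpha x + beta x) + (id ⊗ L SW x) (beta y);
  bialg_talpha_tbeta_prec : forall x y,
    talpha (P x y) + tbeta (P x y) =
      (R NW y ⊗ id) (talpha x + tbeta x) + (id ⊗ L P x) (tbeta y);
  bialg_tau_beta_talpha : forall x y,
    (id ⊗ L S y) (tau (beta x)) - (R W y ⊗ id) (tau (beta x)) =
      (id ⊗ R P x) (talpha y) - (L V x ⊗ id) (talpha y);
  bialg_alpha_talpha_tau : forall x y,
    (id ⊗ R NW x) (alpha y + talpha y) - (L V x ⊗ id) (alpha y + talpha y) =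
      (id ⊗ L NE y) (tau (beta x)) - (R V y ⊗ id) (tau (tbeta x));
  bialg_tau_beta_tbeta : forall x y,
    (R W y ⊗ id) (tau (beta x) + tau (tbeta x))
    - (id ⊗ L SE y) (tau (beta x) + tau (tbeta x)) =
      (L W x ⊗ id) (alpha y) - (id ⊗ R SW x) (talpha y);
  bialg_tau_alpha_beta : forall x y,
    (id ⊗ L S x) (tau (alpha y) + tau (beta y))
    - (R NW x ⊗ id) (tau (alpha y) + tau (beta y)) =
      (id ⊗ R S y) (tbeta x) - (L SW y ⊗ id) (talpha x);
  bialg_tau_talpha_tbeta : forall x y,
    (id ⊗ L SE x) (tau (talpha y) + tau (tbeta y))
    - (R P x ⊗ id) (tau (talpha y) + tau (tbeta y)) =
      (id ⊗ R NE y) (beta x) - (L P y ⊗ id) (alpha x);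
  bialg_total_sw : forall x y,
    alpha (SW x y) + talpha (SW x y) + beta (SW x y) + tbeta (SW x y) =
      (R SW y ⊗ id) (alpha x + beta x) + (id ⊗ L SW x) (beta y + tbeta y);
  bialg_total_ne : forall x y,
    alpha (NE x y) + beta (NE x y) + talpha (NE x y) + tbeta (NE x y) =
      (R NE y ⊗ id) (alpha x + talpha x)
      + (id ⊗ L NE x) (talpha y + tbeta y);
  bialg_mixed : forall x y,
    (L SW y ⊗ id) (alpha x + talpha x)
    + (id ⊗ L NE x) (tau (alpha y) + tau (beta y)) =
      (R SW x ⊗ id) (tau (talpha y) + tau (tbeta y))
      + (id ⊗ R NE y) (beta x + tbeta x) }.

End Bialgebra.

(* Main.v *)
(* A skew-symmetric r is a linear map s : A^* -> A, the contraction [contract r]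
   below, with f (s g) = - g (s f).  Paired with f ⊗ g ⊗ h, the Q-equations read
     f (s g ↙ s h) = g (s h ∧ s f) + h (s f ≻ s g),
     h (s f ↗ s g) = g (s h ∨ s f) + f (s g ≺ s h),
   and a combination of them gives the analogous formulas for ↖ and ↘.  As the
   four dual products are
     (f ↖ g) x =   g (x ↘ s f) + f (s g * x),
     (f ↗ g) x = - g (x ∨ s f) - f (s g ≺ x),
     (f ↙ g) x = - g (x ≻ s f) - f (s g ∧ x),
     (f ↘ g) x =   g (x * s f) + f (s g ↖ x),
   these formulas say exactly that s is a morphism for all four products.
   Replacing s (f ∘ g) by s f ∘ s g turns each quadri-algebra axiom of A^* into a
   consequence of those of A.  The compatibility conditions are linear in r, so
   they only need skew-symmetry: they hold term by term in the products of
   three elements of A, modulo the nine axioms. *)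
Require Import Defs.
From HB Require Import structures.
From mathcomp Require Import all_boot all_order all_algebra.
From mathcomp Require Import ring.
Set Implicit Arguments.
Unset Strict Implicit.
Unset Printing Implicit Defensive.
Import GRing.Theory.
Local Open Scope ring_scope.

(** * Linearity rules for maps given as plain functions *)

Lemma linear_add (F : fieldType) (U W : lmodType F) (f : U -> W) (x y : U) :
  linear f -> f (x + y) = f x + f y.
Proof. by move=> lf; rewrite -[x in LHS]scale1r lf scale1r. Qed.

Lemma linear_zero (F : fieldType) (U W : lmodType F) (f : U -> W) :
  linear f -> f 0 = 0.
Proof. by move=> lf; apply: (addrI (f 0)); rewrite -linear_add // !addr0. Qed.

Lemma linear_opp (F : fieldType) (U W : lmodType F) (f : U -> W) (x : U) :
  linear f -> f (- x) = - f x.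
Proof.
by move=> lf; rewrite -[- x]addr0 -scaleN1r lf linear_zero // addr0 scaleN1r.
Qed.

Lemma linear_scale (F : fieldType) (U W : lmodType F) (f : U -> W) c (x : U) :
  linear f -> f (c *: x) = c *: f x.
Proof. by move=> lf; rewrite -[c *: x]addr0 lf linear_zero // addr0. Qed.

(** * Lifts of bilinear maps and skew-symmetric tensors *)

Section Tensors.
Variable F : fieldType.

Lemma eq_tlift (U V W : vectType F) (b c : U -> V -> W) (t : tensor U V) :
  (forall u v, b u v = c u v) -> tlift b t = tlift c t.
Proof.
by move=> bc; apply: eq_bigr => i _; apply: eq_bigr => j _; rewrite bc.
Qed.

Lemma linear_tlift (U V W W' : vectType F) (h : W -> W') (b : U -> V -> W)
    (t : tensor U V) :
  linear h -> h (tlift b t) = tlift (fun u v => h (b u v)) t.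
Proof.
move=> lh; rewrite /tlift; pose g : {linear W -> W'} :=
  HB.pack h (GRing.isLinear.Build F W W' *:%R h lh).
rewrite -[h]/(g : W -> W') linear_sum; apply: eq_bigr => i _.
by rewrite linear_sum; apply: eq_bigr => j _; rewrite linearZ.
Qed.

Lemma tlift_flip (U W : vectType F) (b : U -> U -> W) (t : tensor U U) :
  is_bilinear b -> tlift b (flip t) = tlift (fun u v => b v u) t.
Proof.
move=> bb; rewrite (linear_tlift _ _ (tlift_linear b)).
by apply: eq_tlift => u v; rewrite tlift_tprod.
Qed.

(** Skew-symmetry enters every later computation in this form: exchanging the two legs costs a
    sign. *)
Lemma tlift_skew (U W : vectType F) (b : U -> U -> W) (t : tensor U U) :
  skew_symmetric t -> is_bilinear b ->
  tlift (fun u v => b v u) t = - tlift b t.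
Proof.
by move=> st bb; rewrite -tlift_flip // st (linear_opp _ (tlift_linear _)).
Qed.

Lemma tprod_bilinear_comp (U V U' V' : vectType F) (f : U -> U') (g : V -> V') :
  linear f -> linear g -> is_bilinear (fun u v => tprod (f u) (g v)).
Proof.
move=> lf lg; have [bl br] := @tprod_bilinear F U' V'.
by split=> [v|u] a x y; rewrite ?lf ?lg; [apply: bl | apply: br].
Qed.

Lemma tmapD (U V U' V' : vectType F) (f : U -> U') (g : V -> V')
    (s t : tensor U V) :
  (f ⊗ g) (s + t) = (f ⊗ g) s + (f ⊗ g) t.
Proof. exact/linear_add/tlift_linear. Qed.

Lemma tmapN (U V U' V' : vectType F) (f : U -> U') (g : V -> V')
    (t : tensor U V) :
  (f ⊗ g) (- t) = - (f ⊗ g) t.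
Proof. exact/linear_opp/tlift_linear. Qed.

(** Merges the nested maps of the compatibility conditions, such as [Rop op y ⊗ id] after
    [id ⊗ Lop op' x], into a single map applied to the tensor. *)
Lemma tmap_comp (U V U' V' U'' V'' : vectType F) (f : U' -> U'') (g : V' -> V'')
    (f' : U -> U') (g' : V -> V') (t : tensor U V) :
  linear f -> linear g -> (f ⊗ g) ((f' ⊗ g') t) = ((f \o f') ⊗ (g \o g')) t.
Proof.
move=> lf lg; rewrite /tmap (linear_tlift _ _ (tlift_linear _)).
apply: eq_tlift => u v; rewrite tlift_tprod //; exact: tprod_bilinear_comp.
Qed.

Lemma flipD (U V : vectType F) (s t : tensor U V) :
  flip (s + t) = flip s + flip t.
Proof. exact/linear_add/tlift_linear. Qed.

Lemma flipN (U V : vectType F) (t : tensor U V) : flip (- t) = - flip t.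
Proof. exact/linear_opp/tlift_linear. Qed.

(** Removes the flips from the compatibility conditions: the flip exchanges the factors [f] and [g],
    and exchanging the legs of [t] to match costs the sign. *)
Lemma flip_tmap_skew (U V W : vectType F) (f : U -> V) (g : U -> W)
    (t : tensor U U) :
  linear f -> linear g -> skew_symmetric t ->
  flip ((f ⊗ g) t) = - (g ⊗ f) t.
Proof.
move=> lf lg st; rewrite /flip /tmap (linear_tlift _ _ (tlift_linear _)).
rewrite -tlift_skew //; last exact: tprod_bilinear_comp.
apply: eq_tlift => u v; rewrite tlift_tprod //.
by have [bl br] := @tprod_bilinear F W V; split.
Qed.

(** A single sum over pairs of basis indices lets tensors built from the same [t] be compared
    summand by summand. *)
Lemma tmapE (U V U' V' : vectType F) (f : U -> U') (g : V -> V')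
    (t : tensor U V) i j :
  ((f ⊗ g) t : 'M[F]_(_, _)) i j =
  \sum_(p : 'I__ * 'I__) (t : 'M[F]_(_, _)) p.1 p.2 *
     (ecoord i (f (ebase p.1)) * ecoord j (g (ebase p.2))).
Proof.
rewrite /tmap /tlift summxE; under eq_bigr do rewrite summxE.
by rewrite pair_bigA; apply: eq_bigr => p _; rewrite !mxE.
Qed.

Lemma ecoordD (U : vectType F) i (u v : U) :
  ecoord i (u + v) = ecoord i u + ecoord i v.
Proof. exact: linearD. Qed.

Lemma ecoordN (U : vectType F) i (u : U) : ecoord i (- u) = - ecoord i u.
Proof. exact: linearN. Qed.

End Tensors.

(** * Bilinearity and a normal form for products of three elements *)

Section QuadriTheory.
Context {F : fieldType} {A : vectType F} {q : quadri_ops A}.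
Hypothesis hq : quadri_algebra q.

Lemma bilinearD (f g : A -> A -> A) :
  is_bilinear f -> is_bilinear g -> is_bilinear (fun x y => f x y + g x y).
Proof.
by move=> [fl fr] [gl gr]; split=> [v|u] a x y; rewrite ?fl ?fr ?gl ?gr;
  rewrite scalerDr addrACA.
Qed.

Lemma succ_bilinear : is_bilinear (succ q).
Proof. by case: hq => *; apply: bilinearD. Qed.
Lemma prec_bilinear : is_bilinear (prec q).
Proof. by case: hq => *; apply: bilinearD. Qed.
Lemma vee_bilinear : is_bilinear (vee q).
Proof. by case: hq => *; apply: bilinearD. Qed.
Lemma wedge_bilinear : is_bilinear (wedge q).
Proof. by case: hq => *; apply: bilinearD. Qed.
Lemma star_bilinear : is_bilinear (star q).
Proof. by case: hq => *; do 3?apply: bilinearD. Qed.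

Lemma linear_Lop (op : A -> A -> A) x : is_bilinear op -> linear (Lop op x).
Proof. by case=> _; apply. Qed.

Lemma linear_Rop (op : A -> A -> A) y : is_bilinear op -> linear (Rop op y).
Proof. by case=> + _; apply. Qed.

Lemma bilinearDl (op : A -> A -> A) x y z :
  is_bilinear op -> op (x + y) z = op x z + op y z.
Proof. by case=> bl _; exact: (linear_add _ _ (bl z)). Qed.

Lemma bilinearDr (op : A -> A -> A) x y z :
  is_bilinear op -> op z (x + y) = op z x + op z y.
Proof. by case=> _ br; exact: (linear_add _ _ (br z)). Qed.

Lemma bilinearNl (op : A -> A -> A) x z :
  is_bilinear op -> op (- x) z = - op x z.
Proof. by case=> bl _; exact: (linear_opp _ (bl z)). Qed.

Lemma bilinearNr (op : A -> A -> A) x z :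
  is_bilinear op -> op z (- x) = - op z x.
Proof. by case=> _ br; exact: (linear_opp _ (br z)). Qed.

Definition quadri_linearE :=
  (fun x y z => bilinearDl x y z (nw_bilinear hq),
   fun x y z => bilinearDl x y z (ne_bilinear hq),
   fun x y z => bilinearDl x y z (sw_bilinear hq),
   fun x y z => bilinearDl x y z (se_bilinear hq),
   (fun x y z => bilinearDr x y z (nw_bilinear hq),
   fun x y z => bilinearDr x y z (ne_bilinear hq),
   fun x y z => bilinearDr x y z (sw_bilinear hq),
   fun x y z => bilinearDr x y z (se_bilinear hq)),
   (fun x z => bilinearNl x z (nw_bilinear hq),
   fun x z => bilinearNl x z (ne_bilinear hq),
   fun x z => bilinearNl x z (sw_bilinear hq),
   fun x z => bilinearNl x z (se_bilinear hq)),
   (fun x z => bilinearNr x z (nw_bilinear hq),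
   fun x z => bilinearNr x z (ne_bilinear hq),
   fun x z => bilinearNr x z (sw_bilinear hq),
   fun x z => bilinearNr x z (se_bilinear hq))).

(* The axioms oriented so that they eliminate nine of the sixteen products
   (x ∘ y) ∘' z. *)
Lemma nw_ne x y z :
  ne q (nw q x y) z = ne q x (succ q y z) - ne q (ne q x y) z.
Proof. by rewrite -(quadri_wedge_ne hq) /wedge /succ !quadri_linearE addrK. Qed.

Lemma sw_ne x y z :
  ne q (sw q x y) z = se q x (ne q y z) - ne q (se q x y) z.
Proof. by rewrite -(quadri_vee_ne hq) /vee !quadri_linearE addrK. Qed.

Lemma nw_sw x y z :
  sw q (nw q x y) z = sw q x (vee q y z) - sw q (sw q x y) z.
Proof. by rewrite -(quadri_prec_sw hq) /prec /vee !quadri_linearE addrK. Qed.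

Lemma ne_sw x y z :
  sw q (ne q x y) z = se q x (sw q y z) - sw q (se q x y) z.
Proof. by rewrite -(quadri_succ_sw hq) /succ !quadri_linearE addrK. Qed.

Lemma nw_se x y z :
  se q (nw q x y) z = se q x (se q y z) - se q (se q x y) z
    - se q (sw q x y) z - se q (ne q x y) z.
Proof. by rewrite -(quadri_star_se hq) /star !quadri_linearE !addrK. Qed.

(** Seven of the sixteen types of left-bracketed products survive, and no rule produces one of the
    nine eliminated types. Identities between triple products thereby become linear identities in
    the remaining ones. *)
Definition quadri_normE :=
  (quadri_nw_nw hq, quadri_ne_nw hq, quadri_sw_nw hq, quadri_se_nw hq,
   (nw_ne, sw_ne, nw_sw, ne_sw, nw_se)).

End QuadriTheory.

(** * The map from the dual to A given by r, and pairings with functionals *)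

Section Contraction.
Context {F : fieldType} {A : vectType F}.
Implicit Types (f g h : dual A) (r : tensor A A).

(** The second leg of [r] is fed to [f]; for skew-symmetric [r], feeding it the first leg gives the
    opposite. *)
Definition contract r f : A := tlift (fun a b => (f b : F) *: a) r.

Lemma contractE (W : vectType F) (phi : A -> W) r f :
  linear phi -> tlift (fun a b => (f b : F) *: phi a) r = phi (contract r f).
Proof.
move=> lphi; rewrite /contract (linear_tlift _ _ lphi).
apply: eq_tlift => a b.
by rewrite linear_scale.
Qed.

Lemma skew_contractE (W : vectType F) (phi : A -> W) r f :
  skew_symmetric r -> linear phi ->
  tlift (fun a b => (f a : F) *: phi b) r = - phi (contract r f).
Proof.
move=> hr lphi; rewrite -contractE // (tlift_skew hr) //.
split=> [v|u] a x y; first by rewrite lphi scalerDr !scalerA mulrC.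
by rewrite linearP scalerDl -scalerA.
Qed.

Lemma contractD r f g : contract r (f + g) = contract r f + contract r g.
Proof.
rewrite /contract /tlift -big_split; apply: eq_bigr => i _.
rewrite -big_split; apply: eq_bigr => j _.
by rewrite add_lfunE scalerDl scalerDr.
Qed.

(** The coordinate functionals of the canonical basis already separate points. *)
Lemma dual_separates (u v : A) : (forall f, f u = f v) -> u = v.
Proof.
move=> uv; rewrite [u]ebase_sum [v]ebase_sum; apply: eq_bigr => i _.
have lc : linear (fun x => ecoord i x : F^o).
  by move=> a x y; rewrite /ecoord linearP.
pose c : {linear A -> F^o} :=
  HB.pack (fun x => ecoord i x : F^o) (GRing.isLinear.Build F A F^o *:%R _ lc).
by have := uv (linfun c); rewrite !lfunE /= => ->.
Qed.

Lemma dualD f (u v : A) : f (u + v) = f u + f v.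
Proof. exact: linearD. Qed.

Lemma dualN f (u : A) : f (- u) = - f u.
Proof. exact: linearN. Qed.

(** Both sides lift the form sending a ⊗ b to f(a) g(b) and apply it to [r]; the right side
    contracts the first leg, hence the sign. *)
Lemma skew_contractC r f g :
  skew_symmetric r -> f (contract r g) = - g (contract r f).
Proof.
move=> hr; rewrite -skew_contractE //; last exact: linearP.
rewrite -contractE; last exact: linearP.
by apply: eq_tlift => a b; rewrite /GRing.scale /= mulrC.
Qed.

Lemma tpair_bilinear f g : is_bilinear (fun a b => f a * g b : F^o).
Proof.
split=> [v|u] a x y; rewrite linearP /=.
  by rewrite mulrDl -mulrA.
by rewrite mulrDr mulrCA.
Qed.

Lemma tpair_tprod f g (a b : A) : tpair f g (tprod a b) = f a * g b.
Proof. by rewrite /tpair (tlift_tprod _ _ (tpair_bilinear f g)). Qed.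

(** Contracting the second leg with [g] leaves the linear form [f] after [u], evaluated at
    [contract r g]. *)
Lemma tpair_tmapl f g r (u : A -> A) :
  linear u -> tpair f g ((u ⊗ id) r) = f (u (contract r g)).
Proof.
move=> lu; have lfu : linear (fun x => f (u x) : F^o).
  by move=> a x y; rewrite lu linearP.
rewrite -(contractE _ _ lfu) /tpair /tmap (linear_tlift _ _ (tlift_linear _)).
by apply: eq_tlift => a b; rewrite -/(tpair f g _) tpair_tprod mulrC.
Qed.

Lemma tpair_tmapr f g r (u : A -> A) : skew_symmetric r ->
  linear u -> tpair f g ((id ⊗ u) r) = - g (u (contract r f)).
Proof.
move=> hr lu; have lgu : linear (fun x => g (u x) : F^o).
  by move=> a x y; rewrite lu linearP.
rewrite -(skew_contractE _ hr lgu) /tpair /tmap.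
rewrite (linear_tlift _ _ (tlift_linear _)).
by apply: eq_tlift => a b; rewrite -/(tpair f g _) tpair_tprod.
Qed.

Definition tpair3 f g h (t : tensor (tensor A A) A) : F^o :=
  tlift (fun u z => tpair f g u * h z : F^o) t.

Lemma tpair3_linear f g h : linear (tpair3 f g h).
Proof. exact: tlift_linear. Qed.

Lemma tpair3_tprod3 f g h (x y z : A) :
  tpair3 f g h (tprod3 x y z) = f x * g y * h z.
Proof.
rewrite /tpair3 tlift_tprod ?tpair_tprod //.
split=> [v|u] a s t; last by rewrite linearP mulrDr mulrCA.
by rewrite /tpair tlift_linear mulrDl -mulrA.
Qed.

Lemma linear_scaler (c : F) : linear (fun x : F^o => c *: x).
Proof. by move=> a x y; rewrite scalerDr !scalerA mulrC. Qed.

(** * Pairing the three tensors of the Q-equations with three functionals *)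

Section Products.
Variables (op : A -> A -> A) (r : tensor A A) (f g h : dual A).
Hypothesis hop : is_bilinear op.

Let linl (k : dual A) y : linear (fun x => k (op x y) : F^o).
Proof. by case: hop => + _ a u v => ->; rewrite linearP. Qed.

Let linr (k : dual A) x : linear (fun y => k (op x y) : F^o).
Proof. by case: hop => _ + a u v => ->; rewrite linearP. Qed.

Let linlN (k : dual A) y : linear (fun x => - k (op x y) : F^o).
Proof. by move=> a u v; rewrite linl opprD scalerN. Qed.

Lemma tpair3_tlift2 (x y z : A -> A -> A -> A -> A) :
  tpair3 f g h (tlift (fun a b => tlift (fun a' b' =>
    tprod3 (x a b a' b') (y a b a' b') (z a b a' b')) r) r) =
  tlift (fun a b => tlift (fun a' b' =>
    f (x a b a' b') * g (y a b a' b') * h (z a b a' b') : F^o) r) r.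
Proof.
rewrite (linear_tlift _ _ (tpair3_linear f g h)); apply: eq_tlift => a b.
rewrite (linear_tlift _ _ (tpair3_linear f g h)); apply: eq_tlift => a' b'.
exact: tpair3_tprod3.
Qed.

(** Both contracted legs are second legs of their copies of [r], so no sign appears. *)
Lemma tpair3_r12_r13 :
  tpair3 f g h (r12_r13 op r) = f (op (contract r g) (contract r h)).
Proof.
rewrite /r12_r13 tpair3_tlift2 -(contractE r g (linl f _)).
apply: eq_tlift => a b; rewrite -(contractE r h (linr f a)).
rewrite (linear_tlift _ _ (linear_scaler _)); apply: eq_tlift => a' b'.
by rewrite /GRing.scale /=; ring.
Qed.

(** Two first legs are contracted, and their signs cancel. *)
Lemma tpair3_r13_r23 : skew_symmetric r ->
  tpair3 f g h (r13_r23 op r) = h (op (contract r f) (contract r g)).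
Proof.
(* The double negation supplies one sign per contraction; the inner one is absorbed into the
   functional built from [- h]. *)
move=> hr; rewrite /r13_r23 tpair3_tlift2 -[RHS]opprK.
rewrite -(skew_contractE f hr (linlN h _)); apply: eq_tlift => a b.
rewrite -(skew_contractE g hr (linr h b)).
rewrite (linear_tlift _ _ (linear_scaler _)); apply: eq_tlift => a' b'.
by rewrite /GRing.scale /=; ring.
Qed.

(** One first and one second leg are contracted, which leaves one sign. *)
Lemma tpair3_r23_r12 : skew_symmetric r ->
  tpair3 f g h (r23_r12 op r) = - g (op (contract r h) (contract r f)).
Proof.
move=> hr; rewrite /r23_r12 tpair3_tlift2.
rewrite -(contractE r h (linlN g _)); apply: eq_tlift => a b.
rewrite -(skew_contractE f hr (linr g a)).
rewrite (linear_tlift _ _ (linear_scaler _)); apply: eq_tlift => a' b'.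
by rewrite /GRing.scale /=; ring.
Qed.

End Products.
End Contraction.

(** * The four comultiplications and the dual products they induce *)

Section DualAlgebra.
Context {F : fieldType} {A : vectType F} {q : quadri_ops A} {r : tensor A A}.
Hypothesis hq : quadri_algebra q.
Hypothesis hr : skew_symmetric r.
Implicit Types (f g h : dual A) (x y : A).

Local Notation NW := (nw q).
Local Notation NE := (ne q).
Local Notation SW := (sw q).
Local Notation SE := (se q).
Local Notation s := (contract r).

Lemma tmapl_linear (op : A -> A -> A) :
  is_bilinear op -> linear (fun x => (Rop op x ⊗ id) r).
Proof.
move=> [_ opr] a x y; rewrite /tmap /tlift scaler_sumr -big_split.
apply: eq_bigr => i _; rewrite scaler_sumr -big_split; apply: eq_bigr => j _ /=.
have [tl _] := @tprod_bilinear F A A.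
by rewrite /Rop opr tl scalerDr !scalerA mulrC.
Qed.

Lemma tmapr_linear (op : A -> A -> A) :
  is_bilinear op -> linear (fun x => (id ⊗ Lop op x) r).
Proof.
move=> [opl _] a x y; rewrite /tmap /tlift scaler_sumr -big_split.
apply: eq_bigr => i _; rewrite scaler_sumr -big_split; apply: eq_bigr => j _ /=.
have [_ tr] := @tprod_bilinear F A A.
by rewrite /Lop opl tr scalerDr !scalerA mulrC.
Qed.

(** The comultiplications of the theorem, in its order, named after the dual products they
    induce. *)
Definition cop_nw x : tensor A A :=
  - (id ⊗ Lop SE x) r + (Rop (star q) x ⊗ id) r.
Definition cop_ne x : tensor A A :=
  (id ⊗ Lop (vee q) x) r - (Rop (prec q) x ⊗ id) r.
Definition cop_sw x : tensor A A :=
  (id ⊗ Lop (succ q) x) r - (Rop (wedge q) x ⊗ id) r.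
Definition cop_se x : tensor A A :=
  - (id ⊗ Lop (star q) x) r + (Rop NW x ⊗ id) r.

Let linearBt (f g : A -> tensor A A) :
  linear f -> linear g -> linear (fun x => f x - g x).
Proof. by move=> lf lg a x y; rewrite lf lg scalerBr opprD addrACA. Qed.

Let linearNDt (f g : A -> tensor A A) :
  linear f -> linear g -> linear (fun x => - f x + g x).
Proof. by move=> lf lg a x y; rewrite lf lg scalerDr scalerN opprD addrACA. Qed.

Lemma cop_nw_linear : linear cop_nw.
Proof.
apply: linearNDt; [exact: tmapr_linear (se_bilinear hq)|].
exact: tmapl_linear (star_bilinear hq).
Qed.

Lemma cop_ne_linear : linear cop_ne.
Proof.
apply: linearBt; [exact: tmapr_linear (vee_bilinear hq)|].
exact: tmapl_linear (prec_bilinear hq).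
Qed.

Lemma cop_sw_linear : linear cop_sw.
Proof.
apply: linearBt; [exact: tmapr_linear (succ_bilinear hq)|].
exact: tmapl_linear (wedge_bilinear hq).
Qed.

Lemma cop_se_linear : linear cop_se.
Proof.
apply: linearNDt; [exact: tmapr_linear (star_bilinear hq)|].
exact: tmapl_linear (nw_bilinear hq).
Qed.

Lemma tpairD f g (t u : tensor A A) :
  tpair f g (t + u) = tpair f g t + tpair f g u.
Proof. exact/linear_add/tlift_linear. Qed.

Lemma tpairN f g (t : tensor A A) : tpair f g (- t) = - tpair f g t.
Proof. exact/linear_opp/tlift_linear. Qed.

Lemma dual_nwE f g x :
  dual_op cop_nw f g x = g (SE x (s f)) + f (star q (s g) x).
Proof.
rewrite dual_opE; last exact: cop_nw_linear.
rewrite tpairD tpairN tpair_tmapr ?tpair_tmapl ?opprK //.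
  exact: linear_Rop (star_bilinear hq).
exact: linear_Lop (se_bilinear hq).
Qed.

Lemma dual_neE f g x :
  dual_op cop_ne f g x = - g (vee q x (s f)) - f (prec q (s g) x).
Proof.
rewrite dual_opE; last exact: cop_ne_linear.
rewrite tpairD tpairN tpair_tmapr ?tpair_tmapl //.
  exact: linear_Rop (prec_bilinear hq).
exact: linear_Lop (vee_bilinear hq).
Qed.

Lemma dual_swE f g x :
  dual_op cop_sw f g x = - g (succ q x (s f)) - f (wedge q (s g) x).
Proof.
rewrite dual_opE; last exact: cop_sw_linear.
rewrite tpairD tpairN tpair_tmapr ?tpair_tmapl //.
  exact: linear_Rop (wedge_bilinear hq).
exact: linear_Lop (succ_bilinear hq).
Qed.

Lemma dual_seE f g x :
  dual_op cop_se f g x = g (star q x (s f)) + f (NW (s g) x).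
Proof.
rewrite dual_opE; last exact: cop_se_linear.
rewrite tpairD tpairN tpair_tmapr ?tpair_tmapl ?opprK //.
  exact: linear_Rop (nw_bilinear hq).
exact: linear_Lop (star_bilinear hq).
Qed.

(** * The Q-equations and the morphism property of the contraction *)

Hypothesis hQ1 :
  r23_r12 (wedge q) r - r13_r23 (succ q) r + r12_r13 (sw q) r = 0.
Hypothesis hQ2 :
  r23_r12 (vee q) r - r12_r13 (prec q) r + r13_r23 (ne q) r = 0.

Lemma contract_Q1 f g h :
  f (SW (s g) (s h)) = g (wedge q (s h) (s f)) + h (succ q (s f) (s g)).
Proof.
have := congr1 (tpair3 f g h) hQ1.
rewrite !(linear_add _ _ (tpair3_linear f g h)).
rewrite (linear_opp _ (tpair3_linear f g h)).
rewrite (linear_zero (tpair3_linear f g h)).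
rewrite (tpair3_r23_r12 _ _ _ (wedge_bilinear hq) hr).
rewrite (tpair3_r13_r23 _ _ _ (succ_bilinear hq) hr).
rewrite (tpair3_r12_r13 _ _ _ _ (sw_bilinear hq)).
by rewrite -opprD addrC => /subr0_eq.
Qed.

Lemma contract_Q2 f g h :
  h (NE (s f) (s g)) = g (vee q (s h) (s f)) + f (prec q (s g) (s h)).
Proof.
have := congr1 (tpair3 f g h) hQ2.
rewrite !(linear_add _ _ (tpair3_linear f g h)).
rewrite (linear_opp _ (tpair3_linear f g h)).
rewrite (linear_zero (tpair3_linear f g h)).
rewrite (tpair3_r23_r12 _ _ _ (vee_bilinear hq) hr).
rewrite (tpair3_r12_r13 _ _ _ _ (prec_bilinear hq)).
rewrite (tpair3_r13_r23 _ _ _ (ne_bilinear hq) hr).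
by rewrite -opprD addrC => /subr0_eq.
Qed.

(** The first Q-identity expresses h(s f ↘ s g) through h(s f ↗ s g), which the second one replaces.
    The terms f(s g ↙ s h) cancel, and the four terms in g add up to [star]. *)
Lemma contract_Q3 f g h :
  h (SE (s f) (s g)) = - g (star q (s h) (s f)) - f (NW (s g) (s h)).
Proof.
have := contract_Q2 f g h; have := contract_Q1 f g h.
rewrite /star /wedge /vee /prec /succ !linearD /= => e d.
have -> : h (SE (s f) (s g)) = f (SW (s g) (s h)) - g (NW (s h) (s f))
    - g (NE (s h) (s f)) - h (NE (s f) (s g)) by rewrite e; ring.
by rewrite d; ring.
Qed.

Definition dual_ops : quadri_ops (dual A) :=
  QuadriOps (dual_op cop_nw) (dual_op cop_ne) (dual_op cop_sw) (dual_op cop_se).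

(** Tested against [h], antisymmetry turns h(s k) into -k(s h) with k the dual product, whose
    explicit formula then applies; the same holds for the other three products. *)
Lemma contract_nw f g : s (nw dual_ops f g) = NW (s f) (s g).
Proof.
apply: dual_separates => h; rewrite (skew_contractC _ _ hr) dual_nwE.
(* Cycling the functionals makes the ↖ term the one evaluated by [h], so one identity serves both ↖
   and ↘. *)
by rewrite (contract_Q3 h f g); ring.
Qed.

Lemma contract_ne f g : s (ne dual_ops f g) = NE (s f) (s g).
Proof.
apply: dual_separates => h; rewrite (skew_contractC _ _ hr) dual_neE.
by rewrite contract_Q2 opprD !opprK.
Qed.

Lemma contract_sw f g : s (sw dual_ops f g) = SW (s f) (s g).
Proof.
apply: dual_separates => h; rewrite (skew_contractC _ _ hr) dual_swE.
by rewrite contract_Q1 opprD !opprK addrC.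
Qed.

Lemma contract_se f g : s (se dual_ops f g) = SE (s f) (s g).
Proof.
apply: dual_separates => h; rewrite (skew_contractC _ _ hr) dual_seE.
by rewrite contract_Q3 opprD.
Qed.


(** * The quadri-algebra axioms on the dual space *)

Lemma dual_op_bilinear (c : A -> tensor A A) :
  linear c -> is_bilinear (dual_op c).
Proof.
move=> lc; split=> [g|f] a f1 f2; apply/lfunP => x;
  rewrite add_lfunE scale_lfunE !dual_opE // /tpair /tlift;
  rewrite scaler_sumr -big_split; apply: eq_bigr => i _;
  rewrite scaler_sumr -big_split; apply: eq_bigr => j _ /=;
  rewrite add_lfunE scale_lfunE /GRing.scale /=; ring.
Qed.

Lemma dual_ops_quadri_algebra : quadri_algebra dual_ops.
Proof.
split; rewrite /=.
- exact: dual_op_bilinear cop_nw_linear.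
- exact: dual_op_bilinear cop_ne_linear.
- exact: dual_op_bilinear cop_sw_linear.
- exact: dual_op_bilinear cop_se_linear.
all: move=> f g h; apply/lfunP => x.
all: rewrite /wedge /vee /prec /succ /star.
all: rewrite ?(add_lfunE, dual_nwE, dual_neE, dual_swE, dual_seE).
(* By the morphism property, only triple products of [x] with contractions of [f], [g], [h]
   remain. *)
all: rewrite ?contractD !(contract_nw, contract_ne, contract_sw, contract_se).
all: rewrite /wedge /vee /prec /succ /star.
all: rewrite ?(quadri_linearE hq) ?(quadri_normE hq).
(* The axioms reintroduce composite products on their right-hand sides, so these are expanded
   again. *)
all: rewrite /wedge /vee /prec /succ /star ?(quadri_linearE hq).
all: rewrite ?(dualD, dualN).
all: ring.
Qed.

Lemma cop_quadri_coalgebra : quadri_coalgebra cop_nw cop_ne cop_sw cop_se.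
Proof.
split; [exact: cop_nw_linear | exact: cop_ne_linear | exact: cop_sw_linear
  | exact: cop_se_linear | exact: dual_ops_quadri_algebra].
Qed.

End DualAlgebra.

(** * The compatibility conditions and the theorem *)

Ltac quadri_bilinear hq := solve [exact: (nw_bilinear hq)
  | exact: (ne_bilinear hq) | exact: (sw_bilinear hq)
  | exact: (se_bilinear hq) | exact: (succ_bilinear hq)
  | exact: (prec_bilinear hq) | exact: (vee_bilinear hq)
  | exact: (wedge_bilinear hq) | exact: (star_bilinear hq)].

Ltac quadri_linear hq := solve [by []
  | apply: linear_Lop; quadri_bilinear hq
  | apply: linear_Rop; quadri_bilinear hq].

(* Skew-symmetry removes the flips; both sides then become sums of terms
   (u ⊗ v) r, compared entrywise. *)
Ltac quadri_compatibility hq hr :=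
  rewrite ?(tmapD, tmapN, flipD, flipN);
  repeat (rewrite flip_tmap_skew;
    [|by quadri_linear hq|by quadri_linear hq|exact: hr]);
  rewrite ?(tmapD, tmapN);
  repeat (rewrite tmap_comp; [|by quadri_linear hq|by quadri_linear hq]);
  apply/matrixP=> i j; rewrite !mxE !tmapE -?(sumrN, big_split) /=;
  apply: eq_bigr => p _; rewrite /Lop /Rop;
  rewrite /wedge /vee /prec /succ /star ?(quadri_linearE hq) ?(quadri_normE hq);
  rewrite /wedge /vee /prec /succ /star ?(quadri_linearE hq);
  rewrite ?(ecoordD, ecoordN);
  ring.

Theorem corollary7p6 (F : fieldType) (A : vectType F) (q : quadri_ops A)
    (r : tensor A A)
    (hq : quadri_algebra q)
    (hr : skew_symmetric r)
    (hQ1 : r23_r12 (wedge q) r - r13_r23 (succ q) r + r12_r13 (sw q) r = 0)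
    (hQ2 : r23_r12 (vee q) r - r12_r13 (prec q) r + r13_r23 (ne q) r = 0) :
  quadri_bialgebra q
    (fun x => - (id ⊗ Lop (se q) x) r + (Rop (star q) x ⊗ id) r)
    (fun x => (id ⊗ Lop (vee q) x) r - (Rop (prec q) x ⊗ id) r)
    (fun x => (id ⊗ Lop (succ q) x) r - (Rop (wedge q) x ⊗ id) r)
    (fun x => - (id ⊗ Lop (star q) x) r + (Rop (nw q) x ⊗ id) r).
Proof.
(* The Q-equations enter here, through the dual quadri-algebra; eighteen compatibility conditions
   remain. *)
split=> //; first exact: cop_quadri_coalgebra.
all: by move=> x y; quadri_compatibility hq hr.
Qed.
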